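(* Let $G$ be a finite simple graph and $u \in V(G)$. Then $\gamma_{gr}^L(G) - 2 \leq \gamma_{gr}^L(G - u) \leq \gamma_{gr}^L(G)$, where $G - u$ is the graph obtained from $G$ by deleting $u$ and all edges incident to it.
   Context: For a vertex $v$, $N(v)$ is its open neighborhood (the set of its neighbors) and $N[v] = N(v) \cup \{v\}$ its closed neighborhood. An L-sequence of a graph $G$ is a sequence $(v_1, \ldots, v_k)$ of distinct vertices of $G$ such that for every $i \in \{1,\ldots,k\}$, $N[v_i] \setminus \bigcup_{j=1}^{i-1} N(v_j) \neq \emptyset$. The L-Grundy domination number $\gamma_{gr}^L(G)$ is the maximum length of an L-sequence of $G$. *)

(* Defs.v *)
From mathcomp Require Import all_boot.

Set Implicit Arguments.
Unset Strict Implicit.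
Unset Printing Implicit Defensive.

Record sgraph := SGraph {
  vertex :> finType;
  adj : rel vertex;
  adj_sym : symmetric adj;
  adj_irr : irreflexive adj
}.

Section Neighborhoods.
Variable G : sgraph.

Definition open_nbh (v : G) : {set G} := [set w | adj v w].

Definition closed_nbh (v : G) : {set G} := v |: open_nbh v.

Definition Lsequence (k : nat) (t : k.-tuple G) : bool :=
  uniq t &&
  [forall i : 'I_k,
     closed_nbh (tnth t i) :\: \bigcup_(j < k | j < i) open_nbh (tnth t j)
       != set0].

(* The entries of an L-sequence are distinct, so its length is at most #|G|;
   LGrundyP below shows that this bound on k loses nothing. *)
Definition LGrundy : nat :=
  \max_(k < #|G|.+1 | [exists t : k.-tuple G, Lsequence t]) k.

Lemma LGrundyP :
  (exists t : LGrundy.-tuple G, Lsequence t) /\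
  (forall (k : nat) (t : k.-tuple G), Lsequence t -> k <= LGrundy).
Proof.
split; last first.
  move=> k t Lt; have kG : k < #|G|.+1.
    case/andP: Lt => /card_uniqP card_t _.
    by have := max_card (mem t); rewrite card_t size_tuple.
  apply: (@leq_bigmax_cond _ _ (fun k : 'I_#|G|.+1 => k : nat) (Ordinal kG)).
  by apply/existsP; exists t.
apply: (big_ind (fun n => exists t : n.-tuple G, Lsequence t))
  => [|m n exm exn|k /existsP //].
  by exists [tuple]; apply/andP; split=> //; apply/forallP => -[].
by rewrite /maxn; case: ifP.
Qed.

End Neighborhoods.

Section VertexDeletion.
Variables (G : sgraph) (u : G).

Definition del_adj : rel {x : G | x != u} := fun x y => adj (val x) (val y).

Lemma del_adj_sym : symmetric del_adj.
Proof. by move=> x y; apply: adj_sym. Qed.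

Lemma del_adj_irr : irreflexive del_adj.
Proof. by move=> x; apply: adj_irr. Qed.

Definition del_vertex : sgraph := SGraph del_adj_sym del_adj_irr.

End VertexDeletion.

(* Main.v *)
Require Import Defs.
From mathcomp Require Import all_boot.

(** An L-sequence of [G - u] is an L-sequence of [G], with the same witnesses.
    Conversely, from an L-sequence of [G] remove [u] and the first neighbour of
    [u].  Once a neighbour of [u] has been played, [u] is dominated, so every
    remaining vertex has a witness other than [u]; hence what remains is an
    L-sequence of [G - u]. *)

(* [P] is the set of vertices already totally dominated before [s] is played. *)
Fixpoint Llegal (G : sgraph) (P : {set G}) (s : seq G) : bool :=
  if s is v :: s' then
    (closed_nbh v :\: P != set0) && Llegal G (P :|: open_nbh v) s'
  else true.
Arguments Llegal {G} P s.

(** Bridge from the recursive form, suited to induction on [s], to the indexed form of [Lsequence].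
    The induction needs an arbitrary [P], since [P] grows with each vertex played. *)
Lemma LlegalP (G : sgraph) (x0 : G) (P : {set G}) (s : seq G) :
  reflect (forall i, i < size s -> exists2 w, w \in closed_nbh (nth x0 s i) :\: P
             & forall j, j < i -> ~~ adj (nth x0 s j) w)
          (Llegal P s).
Proof.
elim: s P => [|v s IHs] P /=; first by constructor.
apply: (iffP andP) => [[/set0Pn[w vw] /IHs Ls] [_|i /Ls[x]]|Ls].
- by exists w.
- rewrite !inE negb_or => /andP[/andP[xP vx] ix] jx.
  by exists x; [rewrite !inE xP | case].
- split; first by apply/set0Pn; have [w vw _] := Ls 0 isT; exists w.
  apply/IHs => i lt_i; have [x] := Ls i.+1 lt_i.
  rewrite !inE => /andP[xP ix] jx; exists x; last by move=> j /(jx j.+1).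
  by rewrite !inE negb_or xP ix (jx 0).
Qed.

Lemma LsequenceE (G : sgraph) (k : nat) (t : k.-tuple G) :
  Lsequence t = uniq t && Llegal set0 t.
Proof.
rewrite /Lsequence; congr (_ && _).
(* The empty tuple is treated apart: [G] may have no vertex to serve as default for [nth]. *)
case: k t => [|k] t; first by rewrite tuple0; apply/forallP => -[].
apply/forallP/(@LlegalP _ (thead t)) => Lt i.
  rewrite size_tuple => lt_i; have /set0Pn[w] := Lt (Ordinal lt_i).
  rewrite in_setD (tnth_nth (thead t)) => /andP[/bigcupP wP iw].
  exists w => [|j lt_ji]; first by rewrite !inE in iw *.
  apply/negP => jw; apply: wP; exists (Ordinal (ltn_trans lt_ji lt_i)) => //.
  by rewrite inE (tnth_nth (thead t)).
have [|w iw jw] := Lt i; first by rewrite size_tuple.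
apply/set0Pn; exists w; rewrite in_setD (tnth_nth (thead t)).
move: iw; rewrite in_setD => /andP[_ ->]; rewrite andbT.
apply/bigcupP => -[j lt_ji]; rewrite inE (tnth_nth (thead t)).
exact/negP/jw.
Qed.

Lemma leq_LGrundy (G : sgraph) (s : seq G) :
  uniq s -> Llegal set0 s -> size s <= LGrundy G.
Proof.
move=> Us Ls; apply: (LGrundyP G).2 (in_tuple s) _.
by rewrite LsequenceE Us.
Qed.

Lemma LGrundy_witness (G : sgraph) :
  exists s : seq G, [/\ uniq s, Llegal set0 s & size s = LGrundy G].
Proof.
have [[t]] := LGrundyP G; rewrite LsequenceE => /andP[Ut Lt] _.
by exists t; rewrite size_tuple.
Qed.

Section Deletion.
Variables (G : sgraph) (u : G).
Implicit Types (P : {set G}) (Q : {set del_vertex u}) (x : del_vertex u).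

Lemma closed_nbh_del x y :
  (y \in closed_nbh x) = (val y \in closed_nbh (val x)).
Proof. by rewrite !inE. Qed.

(** Each witness [w] yields the witness [val w], which differs from [u]; so [P] and [Q] need
    comparing only away from [u]. *)
Lemma Llegal_map_val P Q (s : seq (del_vertex u)) :
  (forall x, val x \in P -> x \in Q) ->
  Llegal Q s -> Llegal P (map val s).
Proof.
elim: s P Q => [//|v s IHs] P Q sPQ /= /andP[/set0Pn[w]].
rewrite in_setD closed_nbh_del => /andP[wQ vw] Ls; apply/andP; split.
  by apply/set0Pn; exists (val w); rewrite in_setD vw (contra (sPQ w)).
apply: IHs Ls => x; rewrite !inE => /orP[/sPQ -> //|vx].
by rewrite [adj v x]vx orbT.
Qed.

(* The slack [u \notin P] pays for the first neighbour of [u] in [s]. *)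
Lemma Llegal_del P Q (s : seq G) :
  (forall x, x \in Q -> val x \in P) -> uniq s -> Llegal P s ->
  exists s' : seq (del_vertex u),
    [/\ subseq (map val s') s, Llegal Q s' &
        size s <= size s' + (u \in s) + (u \notin P)].
Proof.
elim: s P Q => [|v s IHs] P Q sQP /=; first by exists [::].
move=> /andP[vs Us] /andP[/set0Pn[w vw] Ls].
(* A skipped vertex enlarges [P] but not [Q], so an inclusion is the invariant to carry. *)
have sQPv x : x \in Q -> val x \in P :|: open_nbh v.
  by rewrite in_setU => /sQP ->.
(* Dropping [v] is affordable when one of the two slack terms falls from 1 to 0. *)
have skip_v : 1 + (u \in s) + (u \notin P :|: open_nbh v)
               <= (u \in v :: s) + (u \notin P) ->
    exists s' : seq (del_vertex u),
      [/\ subseq (map val s') (v :: s), Llegal Q s' &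
          (size s).+1 <= size s' + (u \in v :: s) + (u \notin P)].
  move=> le_slack; have [s' [ss' Ls' le_s]] := IHs _ _ sQPv Us Ls.
  exists s'; split=> //; first exact: subseq_trans ss' (subseq_cons _ _).
  rewrite -addnA; apply: leq_trans (leq_add (leqnn _) le_slack).
  by rewrite -addnA addnCA add1n ltnS addnA.
(* If [v] is [u], the first term falls, by uniqueness; the second is unchanged because [u] is not
   its own neighbour. *)
have [def_v|neq_vu] := eqVneq v u.
  rewrite def_v in vs skip_v *; apply: skip_v.
  by rewrite !inE eqxx (negPf vs) adj_irr orbF.
(* At the first neighbour of [u], the second term falls. *)
have [/andP[uP vu]|not_first] := boolP ((u \notin P) && adj v u).
  apply: skip_v; rewrite !inE eq_sym (negPf neq_vu) vu orbT uP.
  by rewrite addn0 addnC.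
(* Were [w] equal to [u], then [u] would lie outside [P] and be adjacent to [v], the case just
   excluded. *)
have neq_wu : w != u.
  apply: contraNneq not_first => def_w; move: vw.
  by rewrite def_w !inE eq_sym (negPf neq_vu).
pose v' : del_vertex u := exist _ v neq_vu.
pose w' : del_vertex u := exist _ w neq_wu.
have sQvPv x : x \in Q :|: open_nbh v' -> val x \in P :|: open_nbh v.
  by rewrite !inE => /orP[/sQP -> //|vx]; rewrite [adj v _]vx orbT.
have [s' [ss' Ls' le_s]] := IHs _ _ sQvPv Us Ls.
exists (v' :: s'); split; first by rewrite /= eqxx.
  rewrite /= Ls' andbT; apply/set0Pn; exists w'.
  move: vw; rewrite !in_setD closed_nbh_del => /andP[wP ->].
  by rewrite andbT (contra (sQP w')).
rewrite inE eq_sym (negPf neq_vu) /= !addSn ltnS (leq_trans le_s) // leq_add2l.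
by rewrite !inE; case: (u \in P); case: (adj v u).
Qed.

End Deletion.

Theorem theorem4p3 (G : sgraph) (u : G) :
  LGrundy G - 2 <= LGrundy (del_vertex u) <= LGrundy G.
Proof.
apply/andP; split.
  have [s [Us Ls <-]] := LGrundy_witness G.
  have [x|s' [ss' Ls' le_s]] := Llegal_del G u set0 set0 s _ Us Ls.
    by rewrite inE.
  have Us' : uniq s' by apply: (@map_uniq _ _ val); apply: subseq_uniq ss' Us.
  apply: leq_trans (leq_LGrundy _ _ Us' Ls').
  (* Each slack term is at most 1, whence the constant 2. *)
  rewrite leq_subLR addnC (leq_trans le_s) // -addnA leq_add2l.
  by case: (u \in s); rewrite inE.
have [s [Us Ls <-]] := LGrundy_witness (del_vertex u).
rewrite -(size_map val); apply: leq_LGrundy.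
  by rewrite map_inj_uniq //; apply: val_inj.
by apply: Llegal_map_val Ls => x; rewrite inE.
Qed.
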